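(* Let $x^0\in\mathbb{R}^n$ and $\alpha_0>0$ be such that $\alpha_0\in(\lambda_1,2\lambda_1)$, where $\lambda_1$ is computed from $x^0$ and $x^1=x^0-\alpha_0\nabla f(x^0)$. Then $1\in I_2$, $i_0=0$, and the stepsizes $\{\alpha_k\}$ generated by the general AdaBB algorithm with the choice of $\theta_0$ given in the context satisfy $$\sum_{i=1}^k\alpha_i\ge\frac kL\quad\text{for all }k\ge1.$$
   Context: $\|\cdot\|$ is the Euclidean norm and $B(x,r)$ the closed ball with center $x$ and radius $r$. $f:\mathbb{R}^n\to\mathbb{R}$ is convex and differentiable with locally Lipschitz gradient; its set of minimizers $\mathcal{X}^*$ is nonempty, $f_*=\min f$, and $x^*\in\mathcal{X}^*$ is fixed. General AdaBB algorithm. Input $x^0\in\mathbb{R}^n$, $\alpha_0>0$, $\theta_0\ge0$. Set $x^1=x^0-\alpha_0\nabla f(x^0)$. For $k=1,2,\dots$ let $$\lambda_k=\frac{\langle\nabla f(x^k)-\nabla f(x^{k-1}),x^k-x^{k-1}\rangle}{\|\nabla f(x^k)-\nabla f(x^{k-1})\|^2}.$$ (Case i) If $\lambda_k\ge\alpha_{k-1}$: $\alpha_k=\sqrt{1+\theta_{k-1}}\,\alpha_{k-1}$ and $\theta_k=\alpha_k/\alpha_{k-1}$. (Case ii) If $\alpha_{k-1}/2<\lambda_k<\alpha_{k-1}$: $\alpha_k=\min\left\{\sqrt{\frac{\lambda_k}{2(\alpha_{k-1}-\lambda_k)}},\sqrt{\frac{(1+\theta_{k-1})\lambda_k}{2\lambda_k-\alpha_{k-1}}}\right\}\alpha_{k-1}$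 (Option I) or $\alpha_k=\lambda_k$ (Option II), and $\theta_k=\frac{2\alpha_k}{\alpha_{k-1}}-\frac{\alpha_k}{\lambda_k}$. (Case iii) If $\lambda_k\le\alpha_{k-1}/2$: $\alpha_k=\sqrt{\frac{\alpha_{k-1}}{2(\alpha_{k-1}-\lambda_k)}}\,\lambda_k$ (Option I) or $\alpha_k=\lambda_k/\sqrt2$ (Option II), and $\theta_k=\alpha_k/\alpha_{k-1}$. Then $x^{k+1}=x^k-\alpha_k\nabla f(x^k)$. In each of Cases ii and iii either option may be selected. It is assumed that $\nabla f(x^k)\ne\nabla f(x^{k-1})$ for all $k\ge1$, so that $\lambda_k$ is well defined. Choice of $\theta_0$: $\theta_0=\frac{\lambda_1^2}{2\alpha_0^2}-1$ if $\lambda_1\ge\sqrt2\,\alpha_0$, and $\theta_0=0$ otherwise. Define - $M_1=0$, $P_1=\frac{\alpha_1^2}{\alpha_0}$ if $\lambda_1\ge\alpha_0$; - $M_1=\frac{\alpha_1^2}{\lambda_1\alpha_0}-\frac{\alpha_1^2}{\alpha_0^2}$, $P_1=\frac{2\alpha_1^2}{\alpha_0}-\frac{\alpha_1^2}{\lambda_1}$ if $\frac{\alpha_0}2<\lambda_1<\alpha_0$; - $M_1=\frac{\alpha_1^2}{\lambda_1^2}-\frac{\alpha_1^2}{\alpha_0\lambda_1}$, $P_1=\frac{\alpha_1^2}{\alpha_0}$ if $0<\lambda_1\le\frac{\alpha_0}2$. Local smoothness: $L>0$ is such that $f(x)-f(y)-\langle\nabla f(y),x-y\rangle\ge\frac1{2L}\|\nabla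 f(x)-\nabla f(y)\|^2$ for all $x,y\in B(x^*,R)$, where $R^2=\|x^0-x^*\|^2+\alpha_0^2(1+2M_1)\|\nabla f(x^0)\|^2+\max\{2P_1-2\alpha_0,0\}(f(x^0)-f_* )$. Index sets: $I_1=\{k\ge1:\lambda_k\ge\alpha_{k-1}\}$, $I_2=\{k\ge1:\alpha_{k-1}/2<\lambda_k<\alpha_{k-1}\}$, $I_3=\{k\ge1:0<\lambda_k\le\alpha_{k-1}/2\}$. Definition of $i_0$: - $i_0=0$ if $1\in I_2$, or $(1,2)\in I_1\times I_3$, or $(1,2)\in I_3\times I_3$; - $i_0=1$ if $(1,2)\in I_1\times I_1$, or $(1,2)\in I_1\times I_2$, or $(1,2)\in I_3\times I_2$, or $(1,2,3)\in I_3\times I_1\times I_3$; - $i_0=2$ if $(1,2,3)\in I_3\times I_1\times I_1$, or $(1,2,3)\in I_3\times I_1\times I_2$. *)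

(* Defs.v *)
From mathcomp Require Import all_boot all_order all_algebra.
From mathcomp Require Import all_classical all_reals all_analysis.

Set Implicit Arguments.
Unset Strict Implicit.
Unset Printing Implicit Defensive.

Import Order.TTheory GRing.Theory Num.Theory.
Import numFieldNormedType.Exports.

Local Open Scope classical_set_scope.
Local Open Scope ring_scope.

(* The canonical norm on 'rV[R]_n is the sup norm, so the Euclidean structure
   is set up by hand. Differentiability is unaffected by the choice of norm. *)
Definition dot (R : realType) (n : nat) (u v : 'rV[R]_n) : R :=
  \sum_(i < n) u 0 i * v 0 i.

Definition enorm (R : realType) (n : nat) (u : 'rV[R]_n) : R :=
  Num.sqrt (dot u u).

Definition eball (R : realType) (n : nat) (c : 'rV[R]_n) (r : R) :
  set 'rV[R]_n := [set x | enorm (x - c) <= r].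

Definition grad (R : realType) (n : nat) (f : 'rV[R]_n -> R) (x : 'rV[R]_n) :
  'rV[R]_n := \row_(i < n) 'd f x (delta_mx 0 i).

Lemma dot_grad (R : realType) (n : nat) (f : 'rV[R]_n -> R) (x v : 'rV[R]_n) :
  dot (grad f x) v = 'd f x v.
Proof.
rewrite [in RHS](row_sum_delta v) linear_sum; apply: eq_bigr => i _.
by rewrite linearZ mxE mulrC.
Qed.

Definition locally_lipschitz (R : realType) (n : nat)
    (g : 'rV[R]_n -> 'rV[R]_n) : Prop :=
  forall z : 'rV[R]_n, exists K : R,
    \forall u \near z & v \near z, enorm (g u - g v) <= K * enorm (u - v).

Definition minimizers (R : realType) (n : nat) (f : 'rV[R]_n -> R) :
  set 'rV[R]_n := [set x | forall y, f x <= f y].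

(* Meaningful for k >= 1, as are all uses of k.-1 below. *)
Definition bb_lambda (R : realType) (n : nat) (f : 'rV[R]_n -> R)
    (x : nat -> 'rV[R]_n) (k : nat) : R :=
  let dg := grad f (x k) - grad f (x k.-1) in
  dot dg (x k - x k.-1) / enorm dg ^+ 2.

(* One update (a', t') = (alpha_{k-1}, theta_{k-1}) |-> (a, t) = (alpha_k,
   theta_k), with l = lambda_k. It is a relation because Options I and II may
   be chosen freely at every iteration. *)
Definition adabb_step (R : realType) (l a' t' a t : R) : Prop :=
  [\/ [/\ a' <= l,
          a = Num.sqrt (1 + t') * a' &
          t = a / a'],
      [/\ a' / 2 < l < a',
          a = Num.min (Num.sqrt (l / (2 * (a' - l))))
                      (Num.sqrt ((1 + t') * l / (2 * l - a'))) * a' \/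
          a = l &
          t = 2 * a / a' - a / l] |
      [/\ l <= a' / 2,
          a = Num.sqrt (a' / (2 * (a' - l))) * l \/
          a = l / Num.sqrt 2 &
          t = a / a']].

Definition adabb (R : realType) (n : nat) (f : 'rV[R]_n -> R)
    (x : nat -> 'rV[R]_n) (alpha theta : nat -> R) : Prop :=
  [/\ 0 < alpha 0%N,
      0 <= theta 0%N,
      forall k : nat, x k.+1 = x k - alpha k *: grad f (x k) &
      forall k : nat, (1 <= k)%N ->
        adabb_step (bb_lambda f x k) (alpha k.-1) (theta k.-1)
                   (alpha k) (theta k)].

Definition theta0_choice (R : realType) (lam1 a0 : R) : R :=
  if Num.sqrt 2 * a0 <= lam1 then lam1 ^+ 2 / (2 * a0 ^+ 2) - 1 else 0.

(* The last branch of adabb_M1 and adabb_P1 is the case 0 < lam1 <= a0 / 2. *)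
Definition adabb_M1 (R : realType) (lam1 a0 a1 : R) : R :=
  if a0 <= lam1 then 0
  else if a0 / 2 < lam1 then a1 ^+ 2 / (lam1 * a0) - a1 ^+ 2 / a0 ^+ 2
  else a1 ^+ 2 / lam1 ^+ 2 - a1 ^+ 2 / (a0 * lam1).

Definition adabb_P1 (R : realType) (lam1 a0 a1 : R) : R :=
  if a0 <= lam1 then a1 ^+ 2 / a0
  else if a0 / 2 < lam1 then 2 * a1 ^+ 2 / a0 - a1 ^+ 2 / lam1
  else a1 ^+ 2 / a0.

Definition adabb_radius (R : realType) (n : nat) (f : 'rV[R]_n -> R)
    (xstar : 'rV[R]_n) (x : nat -> 'rV[R]_n) (alpha : nat -> R) : R :=
  let M1 := adabb_M1 (bb_lambda f x 1) (alpha 0%N) (alpha 1%N) in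
  let P1 := adabb_P1 (bb_lambda f x 1) (alpha 0%N) (alpha 1%N) in
  Num.sqrt (enorm (x 0%N - xstar) ^+ 2
    + alpha 0%N ^+ 2 * (1 + 2 * M1) * enorm (grad f (x 0%N)) ^+ 2
    + Num.max (2 * P1 - 2 * alpha 0%N) 0 * (f (x 0%N) - f xstar)).

Definition smooth_on (R : realType) (n : nat) (f : 'rV[R]_n -> R)
    (B : set 'rV[R]_n) (L : R) : Prop :=
  forall x y : 'rV[R]_n, B x -> B y ->
    1 / (2 * L) * enorm (grad f x - grad f y) ^+ 2
      <= f x - f y - dot (grad f y) (x - y).

Definition index_set1 (R : realType) (lam alpha : nat -> R) : set nat :=
  [set k | (1 <= k)%N /\ alpha k.-1 <= lam k].

Definition index_set2 (R : realType) (lam alpha : nat -> R) : set nat :=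
  [set k | (1 <= k)%N /\ alpha k.-1 / 2 < lam k < alpha k.-1].

Definition index_set3 (R : realType) (lam alpha : nat -> R) : set nat :=
  [set k | (1 <= k)%N /\ 0 < lam k <= alpha k.-1 / 2].

(* is_i0 lam alpha i states that the case distinction defining i_0 assigns it
   the value i. *)
Definition is_i0 (R : realType) (lam alpha : nat -> R) (i : nat) : Prop :=
  let I1 := index_set1 lam alpha in
  let I2 := index_set2 lam alpha in
  let I3 := index_set3 lam alpha in
  [\/ i = 0%N /\
        [\/ I2 1%N, I1 1%N /\ I3 2%N | I3 1%N /\ I3 2%N],
      i = 1%N /\
        [\/ I1 1%N /\ I1 2%N, I1 1%N /\ I2 2%N, I3 1%N /\ I2 2%N |
            [/\ I3 1%N, I1 2%N & I3 3%N]] |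
      i = 2%N /\
        ([/\ I3 1%N, I1 2%N & I1 3%N] \/ [/\ I3 1%N, I1 2%N & I2 3%N])].

(* Main.v *)
Require Import Defs.
From mathcomp Require Import all_boot all_order all_algebra.
From mathcomp Require Import all_classical all_reals all_analysis.
From mathcomp Require Import ring lra.

Import Order.TTheory GRing.Theory Num.Theory.
Import numFieldNormedType.Exports.

(** Write g_k for the gradient of f at x_k, F_k for f(x_k) - f(x-star) and d_k
for the squared distance from x_k to x-star.  Two facts are combined.

The iterates stay in the ball on which L is given.  The energy
  d_(k+1) + alpha_k^2 |g_k|^2 + 2 alpha_k (1 + theta_k) F_k
does not increase ([energy_le]).  A gradient step gives
  d_(k+2) <= d_(k+1) - 2 alpha_(k+1) F_(k+1) + alpha_(k+1)^2 |g_(k+1)|^2,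
and the three stepsize rules are made so that the last term, counted twice, is
at most alpha_k^2 |g_k|^2 + 2 alpha_(k+1) theta_(k+1) (F_k - F_(k+1))
([step_grad]), while alpha_(k+1) theta_(k+1) <= alpha_k (1 + theta_k)
([step_theta]).  The second copy of that term enters the new energy.  The squared radius bounds
the energy at index 1 by the same computation, in which M_1 and P_1 are the exact
constants of the first step ([energy1_le]).  On the ball, lambda_k >= 1/L by
cocoercivity of the gradient ([smooth_bb_lambda]); since the inequalities for
step k need lambda_k > 0, boundedness and the lower bound on lambda are proved
in one induction ([adabb_bounded]).

The stepsizes then satisfy the bound for purely arithmetical reasons
([sum_stepsizes]).  Put c = 1/L.  Case i does not decrease alpha and case ii
gives alpha_k >= lambda_k >= c, so alpha drops below c only in case iii,
where still alpha_k >= c / sqrt 2 and the previous stepsize is at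
least 2c.  If case i follows twice, the second time multiplies alpha
by at least sqrt 2, so at most two consecutive stepsizes are below c.  Their
total deficit, at most (2 - sqrt 2) c, is paid by the excess of the stepsize
preceding case iii; it exists because case iii is excluded at k = 1. *)

Set Implicit Arguments.
Unset Strict Implicit.

Local Open Scope classical_set_scope.
Local Open Scope ring_scope.

(** * Euclidean inner product *)

Section Dot.
Variables (R : realType) (n : nat).
Implicit Types u v w : 'rV[R]_n.

Lemma dotC u v : dot u v = dot v u.
Proof. by apply: eq_bigr => i _; rewrite mulrC. Qed.

Lemma dotDl u v w : dot (u + v) w = dot u w + dot v w.
Proof. by rewrite -big_split; apply: eq_bigr => i _; rewrite mxE mulrDl. Qed.

Lemma dotZl (a : R) u w : dot (a *: u) w = a * dot u w.
Proof. by rewrite mulr_sumr; apply: eq_bigr => i _; rewrite mxE mulrA. Qed.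

Lemma dotBl u v w : dot (u - v) w = dot u w - dot v w.
Proof. by rewrite -scaleN1r dotDl dotZl mulN1r. Qed.

Lemma dotDr u v w : dot w (u + v) = dot w u + dot w v.
Proof. by rewrite dotC dotDl !(dotC w). Qed.

Lemma dotZr (a : R) u w : dot w (a *: u) = a * dot w u.
Proof. by rewrite dotC dotZl (dotC w). Qed.

Lemma dotNr u w : dot w (- u) = - dot w u.
Proof. by rewrite -scaleN1r dotZr mulN1r. Qed.

Lemma dotBr u v w : dot w (u - v) = dot w u - dot w v.
Proof. by rewrite dotC dotBl !(dotC w). Qed.

Lemma dot_ge0 u : 0 <= dot u u.
Proof. by apply: sumr_ge0 => i _; rewrite -expr2 sqr_ge0. Qed.

Lemma dot_gt0 u : u <> 0 -> 0 < dot u u.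
Proof.
move=> u_neq0; rewrite lt_neqAle dot_ge0 andbT eq_sym; apply/eqP => /eqP.
rewrite psumr_eq0 => [/allP u0|i _]; last by rewrite -expr2 sqr_ge0.
apply: u_neq0; apply/rowP => i; rewrite mxE.
by have := u0 i (mem_index_enum i); rewrite mulf_eq0 orbb => /eqP.
Qed.

Lemma enorm_sqr u : enorm u ^+ 2 = dot u u.
Proof. by rewrite sqr_sqrtr ?dot_ge0. Qed.

End Dot.

(** * Convexity and the secant through two iterates *)

(** By convexity the difference quotients of f from x towards y are at most
f y - f x; the directional derivative is their limit from the right. *)
Lemma convex_grad_le (R : realType) (n : nat) (f : 'rV[R]_n -> R)
    (f_convex : convex_function setT f) (x y : 'rV[R]_n) :
  differentiable f x -> dot (grad f x) (y - x) <= f y - f x.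
Proof.
move=> f_diff; rewrite dot_grad -deriveE//.
have df : derivable f x (y - x) by exact: diff_derivable.
rewrite /derive cvg_at_rightE//.
apply: limr_le; first by apply: cvgP; exact: cvg_dnbhs_at_right df.
near=> h.
have h0 : 0 < h by [].
have h1 : h <= 1 by apply: ltW; near: h; exact: nbhs_right_lt.
have /= := f_convex (Itv01 (ltW h0) h1) y x (in_setT _) (in_setT _).
rewrite convRE /= [X in f X <= _](_ : _ = h *: (y - x) + x); last first.
  by rewrite /conv /= /unstable.onem scalerBl scale1r scalerBr addrA addrAC.
rewrite /unstable.onem /GRing.scale /= ler_pdivrMl// => fconv; lra.
Unshelve. all: by end_near. Qed.

Lemma gradient_step_dist (R : realType) (n : nat) (f : 'rV[R]_n -> R)
    (xstar x : 'rV[R]_n) (a : R) :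
  convex_function setT f -> differentiable f x -> 0 <= a ->
  dot (x - a *: grad f x - xstar) (x - a *: grad f x - xstar) <=
    dot (x - xstar) (x - xstar) - 2 * a * (f x - f xstar)
    + a ^+ 2 * dot (grad f x) (grad f x).
Proof.
move=> f_convex f_diff a0.
have : dot (grad f x) (xstar - x) <= f xstar - f x by exact: convex_grad_le.
rewrite addrAC -(opprB x xstar); move: (x - xstar) (grad f x) => d g.
rewrite dotNr !(dotBl, dotBr, dotZl, dotZr) (dotC d g) => h.
have : a * (f x - f xstar) <= a * dot g d by apply: ler_wpM2l => //; lra.
lra.
Qed.

(** For a gradient step, the definition of l = lambda determines <g, g'> and
|g|^2 from |g'|^2 and D = |g - g'|^2.  The third relation is the Cauchy-Schwarz
bound l sqrt D <= a |g'|; it comes from expanding |l (g - g') + a g'|^2 >= 0. *)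
Lemma secant_relations (R : realType) (n : nat) (g' g dx : 'rV[R]_n) (a l : R) :
  dx = - (a *: g') -> l * dot (g - g') (g - g') = dot (g - g') dx ->
  [/\ a * dot g g = a * dot g' g' + (a - 2 * l) * dot (g - g') (g - g'),
      a * dot g g' = a * dot g' g' - l * dot (g - g') (g - g') &
      l ^+ 2 * dot (g - g') (g - g') <= a ^+ 2 * dot g' g'].
Proof.
move=> -> lE.
have := dot_ge0 (l *: (g - g') + a *: g').
move: lE.
rewrite !(dotBl, dotBr, dotDl, dotDr, dotNr, dotZl, dotZr) (dotC g' g).
move: (dot g g) (dot g g') (dot g' g') => G p G' lE sq.
split; [lra|lra|].
have /= := congr1 ( *%R l) lE.
lra.
Qed.

Lemma bb_lambdaE (R : realType) (n : nat) (f : 'rV[R]_n -> R)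
    (x : nat -> 'rV[R]_n) (k : nat) : grad f (x k.+1) <> grad f (x k) ->
  bb_lambda f x k.+1 *
      dot (grad f (x k.+1) - grad f (x k)) (grad f (x k.+1) - grad f (x k)) =
    dot (grad f (x k.+1) - grad f (x k)) (x k.+1 - x k).
Proof.
move=> neq; rewrite /bb_lambda; set dg := grad f _ - grad f _.
have dg_neq0 : dg <> 0 by move=> /subr0_eq.
have D_neq0 : dot dg dg != 0 by exact: lt0r_neq0 (dot_gt0 dg_neq0).
rewrite [enorm _ ^+ 2]enorm_sqr.
exact: divfK.
Qed.

(** Adding the smoothness inequality for (x_k, x_(k+1)) and for
(x_(k+1), x_k) cancels the values of f and leaves cocoercivity. *)
Lemma smooth_bb_lambda (R : realType) (n : nat) (f : 'rV[R]_n -> R) B (L : R)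
    (x : nat -> 'rV[R]_n) (k : nat) :
  0 < L -> smooth_on f B L -> B (x k) -> B (x k.+1) ->
  grad f (x k.+1) <> grad f (x k) -> 1 / L <= bb_lambda f x k.+1.
Proof.
move=> L0 smooth Bk Bk1 neq.
have := smooth _ _ Bk Bk1; have := smooth _ _ Bk1 Bk.
have := bb_lambdaE neq.
move: neq (bb_lambda f x k.+1) (f (x k)) (f (x k.+1)) => neq l f' f1.
move: (grad f (x k)) (grad f (x k.+1)) neq => g' g neq lE.
have D0 : 0 < dot (g - g') (g - g') by apply: dot_gt0 => /subr0_eq.
rewrite !enorm_sqr => sm1 sm2; rewrite -(ler_pM2r D0) lE; move: sm1 sm2.
have -> : 1 / (2 * L) = 1 / L / 2 by field; lra.
move: (1 / L) => c.
rewrite !(dotBl, dotBr) (dotC g' g).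
lra.
Qed.

(** * One stepsize update *)

Section Stepsize.
Variables (R : realType).
Implicit Types l a b t : R.

Lemma ler_sqrtM (A a l : R) : 0 <= A -> 0 <= a -> l ^+ 2 <= A * a ^+ 2 ->
  l <= Num.sqrt A * a.
Proof.
move=> A0 a0 h; apply: le_trans (ler_norm l) _.
rewrite -(ger0_norm a0) -!sqrtr_sqr -sqrtrM//.
exact: ler_wsqrtr.
Qed.

(** The inequalities that Options I and II have in common, freed from square
roots and minima; everything below uses only these. *)
Variant step_bounds l a t' b t : Prop :=
| StepLong of a <= l & b ^+ 2 = (1 + t') * a ^+ 2 & a <= b & t = b / a
| StepMiddle of a < 2 * l & l < a & l <= b
    & b ^+ 2 * (2 * (a - l)) <= a ^+ 2 * l
    & b ^+ 2 * (2 * l - a) <= (1 + t') * a ^+ 2 * l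
    & t = 2 * b / a - b / l
| StepShort of 2 * l <= a & 0 < b & b <= l & l ^+ 2 <= 2 * b ^+ 2
    & b ^+ 2 * (2 * (a - l)) <= a * l ^+ 2 & t = b / a.

Lemma adabb_stepP l a t' b t : 0 < l -> 0 < a -> 0 <= t' ->
  adabb_step l a t' b t -> step_bounds l a t' b t.
Proof.
move=> l0 a0 t'0.
case=> [[al bE tE]|[/andP[al la] bE tE]|[al bE tE]].
- apply: StepLong => //; rewrite bE; first by rewrite exprMn sqr_sqrtr; lra.
  by apply: ler_sqrtM; nra.
- have la0 : 0 < a - l by lra.
  have la1 : 0 < 2 * l - a by lra.
  (* amgm places l below a times the first radical of Option I; slack and grow
     together place it below a times the second.  The same inequalities give the
     two upper bounds on b^2 when b = l, i.e. for Option II. *)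
  have amgm : 2 * l * (a - l) <= a ^+ 2 by nra.
  have slack : l * (2 * l - a) <= a ^+ 2 by nra.
  have grow : a ^+ 2 <= (1 + t') * a ^+ 2 by nra.
  apply: StepMiddle => //; [lra|..].
  + case: bE => -> //.
    rewrite minr_pMl ?(ltW a0)// le_min; apply/andP; split; apply: ler_sqrtM; try lra.
    * by apply: divr_ge0; lra.
    * by rewrite mulrAC ler_pdivlMr; [nra|lra].
    * by apply: divr_ge0; nra.
    * by rewrite mulrAC ler_pdivlMr//; nra.
  + case: bE => ->; last by nra.
    set A := l / _; set B := (X in Num.min _ (Num.sqrt X)).
    have A0 : 0 <= A by apply: divr_ge0; lra.
    have mA : Num.min (Num.sqrt A) (Num.sqrt B) ^+ 2 <= A.
      by rewrite -[leRHS]sqr_sqrtr// ler_sqr ?nnegrE ?le_min ?sqrtr_ge0 ?ge_min ?lexx.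
    have -> : a ^+ 2 * l = A * a ^+ 2 * (2 * (a - l)) by rewrite /A; field; lra.
    by rewrite exprMn; apply: ler_wpM2r; [lra|apply: ler_wpM2r; [nra|]].
  + case: bE => ->; last by nra.
    set A := l / _; set B := (X in Num.min _ (Num.sqrt X)).
    have B0 : 0 <= B by apply: divr_ge0; nra.
    have mB : Num.min (Num.sqrt A) (Num.sqrt B) ^+ 2 <= B.
      by rewrite -[leRHS]sqr_sqrtr// ler_sqr ?nnegrE ?le_min ?sqrtr_ge0 ?ge_min ?lexx ?orbT.
    have -> : (1 + t') * a ^+ 2 * l = B * a ^+ 2 * (2 * l - a) by rewrite /B; field; lra.
    by rewrite exprMn; apply: ler_wpM2r; [lra|apply: ler_wpM2r; [nra|]].
- have la0 : 0 < a - l by lra.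
  have [b0 bb] : 0 < b /\ (l ^+ 2 <= 2 * b ^+ 2) /\ (b ^+ 2 * (2 * (a - l)) <= a * l ^+ 2).
    case: bE => ->.
      set A := a / _.
      have A0 : 0 < A by apply: divr_gt0; lra.
      have AE : A * (2 * (a - l)) = a by rewrite /A; field; lra.
      have A1 : 1 <= 2 * A by nra.
      split; first by rewrite mulr_gt0 ?sqrtr_gt0.
      rewrite exprMn sqr_sqrtr ?(ltW A0)//; split; first by nra.
      by rewrite mulrAC AE lexx.
    split; first by rewrite divr_gt0 ?sqrtr_gt0.
    rewrite expr_div_n sqr_sqrtr//; split; first lra.
    have : 0 < l ^+ 2 by nra.
    nra.
  case: bb => bb1 bb2.
  apply: StepShort => //; first lra.
  rewrite -ler_sqr ?nnegrE ?(ltW b0) ?(ltW l0)//.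
  have : b ^+ 2 * (2 * (a - l)) <= l ^+ 2 * (2 * (a - l)) by nra.
  by rewrite ler_pM2r; lra.
Qed.

Lemma step_gt0 l a t' b t : 0 < l -> 0 < a ->
  step_bounds l a t' b t -> 0 < b /\ 0 <= t.
Proof.
move=> l0 a0; case=> [al bE ab ->|al la lb _ _ ->|al b0 bl _ _ ->].
- by split; [lra|apply: divr_ge0; lra].
- split; first lra.
  have -> : 2 * b / a - b / l = b * (2 * l - a) / (a * l) by field; lra.
  by apply: divr_ge0; nra.
- by split; [lra|apply: divr_ge0; lra].
Qed.

Lemma step_theta l a t' b t : 0 < l -> 0 < a -> 0 <= t' ->
  step_bounds l a t' b t -> b * t <= a * (1 + t').
Proof.
move=> l0 a0 t'0; case=> [al bE ab ->|al la lb _ bM ->|al b0 bl _ _ ->].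
- by rewrite mulrA -expr2 bE ler_pdivrMr//; lra.
- have -> : b * (2 * b / a - b / l) = b ^+ 2 * (2 * l - a) / (a * l).
    by field; lra.
  by rewrite ler_pdivrMr; nra.
- by rewrite mulrA -expr2 ler_pdivrMr//; nra.
Qed.

(** Here and in the next lemma, G = |g|^2, G' = |g'|^2, p = <g, g'> and
D = |g - g'|^2 for consecutive gradients g' and g.  In case ii this is an
equality, which is what makes M_1 and P_1 appear at the first step. *)
Lemma middle_step_grad l a b t G' p G D : l != 0 -> a != 0 ->
  t = 2 * b / a - b / l ->
  a * G = a * G' + (a - 2 * l) * D -> a * p = a * G' - l * D ->
  b ^+ 2 * G = b ^+ 2 * (a / l - 1) * G' + b * t * (a * p).
Proof.
move=> l0 a0 -> GE ->.
have -> : G = (a * G' + (a - 2 * l) * D) / a by rewrite -GE mulrC mulKf.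
by field; rewrite l0 a0.
Qed.

(** Since a p <= F' - F by convexity, this bounds b^2 |g|^2 by quantities of the
previous step.  In cases i and iii, a G - a p = (a - l) D: the right side is
nonpositive in case i, and in case iii it is controlled by |g'|^2 through the
Cauchy-Schwarz bound on D. *)
Lemma step_grad l a t' b t G' p G D : 0 < l -> 0 < a ->
  step_bounds l a t' b t -> 0 <= G' -> 0 <= D -> l ^+ 2 * D <= a ^+ 2 * G' ->
  a * G = a * G' + (a - 2 * l) * D -> a * p = a * G' - l * D ->
  2 * b ^+ 2 * G <= a ^+ 2 * G' + 2 * b * t * (a * p).
Proof.
move=> l0 a0 st G'0 D0 lD GE pE.
have a2G' : 0 <= a ^+ 2 * G' by nra.
have [lneq aneq] : l != 0 /\ a != 0 by rewrite !gt_eqF.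
have excess : 2 * b ^+ 2 * G - 2 * b * (b / a) * (a * p)
    = b ^+ 2 * (2 * (a - l)) * D / a.
  have -> : G = (a * G' + (a - 2 * l) * D) / a by rewrite -GE mulrC mulKf.
  by rewrite pE; field.
case: st => [al bE ab tE|al la lb bA _ tE|al b0 bl _ bA tE].
- rewrite tE -lerBlDr excess; apply: le_trans a2G'.
  rewrite ler_pdivrMr// mul0r -mulrA mulr_ge0_le0 ?sqr_ge0//; nra.
- rewrite -mulrA (middle_step_grad lneq aneq tE GE pE).
  suff : 2 * (b ^+ 2 * (a / l - 1) * G') <= a ^+ 2 * G' by lra.
  have -> : 2 * (b ^+ 2 * (a / l - 1) * G') = b ^+ 2 * (2 * (a - l)) * G' / l.
    by field.
  by rewrite ler_pdivrMr// [leRHS]mulrAC; apply: ler_wpM2r.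
- rewrite tE -lerBlDr excess ler_pdivrMr//.
  have : b ^+ 2 * (2 * (a - l)) * D <= a * l ^+ 2 * D by apply: ler_wpM2r.
  nra.
Qed.

End Stepsize.

(** * Sum of the stepsizes *)

(** The surplus S k = sum - k c is nonnegative, but induction needs more.  A state
is one of: alpha >= c; just after case iii with h = c / sqrt 2 <= alpha < c,
where S >= h is left after paying once; or case i after that, with
theta >= 1 and S >= 2 h - c left after paying twice.  In the third state
another case i multiplies alpha by at least sqrt 2, and from the last two
states case iii is impossible because it requires alpha >= 2 c. *)
Lemma sum_stepsizes (R : realType) (c : R) (lam alpha theta : nat -> R) :
  0 < c -> 0 < alpha 0%N -> 0 <= theta 0%N -> c <= alpha 1%N ->
  (forall k, c <= lam k.+1) ->
  (forall k, step_bounds (lam k.+1) (alpha k) (theta k) (alpha k.+1) (theta k.+1)) ->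
  forall k : nat, k%:R * c <= \sum_(1 <= i < k.+1) alpha i.
Proof.
move=> c0 a0 t0 a1 lamc st.
have [a_gt0 th_ge0] : (forall k, 0 < alpha k) /\ (forall k, 0 <= theta k).
  suff a_th : forall k, 0 < alpha k /\ 0 <= theta k.
    by split=> k; have [] := a_th k.
  elim=> [|k [ak _]] //.
  exact: step_gt0 (lt_le_trans c0 (lamc k)) ak (st k).
pose h := c / Num.sqrt 2; pose S k := \sum_(1 <= i < k.+1) alpha i - k%:R * c.
have s2 : Num.sqrt 2 ^+ 2 = 2 :> R by rewrite sqr_sqrtr.
have s0 : 0 < Num.sqrt 2 :> R by rewrite sqrtr_gt0.
have h0 : 0 < h by rewrite divr_gt0.
have hE : 2 * h ^+ 2 = c ^+ 2 by rewrite /h expr_div_n s2; field.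
have SS k : S k.+1 = S k + (alpha k.+1 - c).
  by rewrite /S big_nat_recr//= -natr1; ring.
have inv k : [\/ [/\ c <= alpha k.+1, 0 <= S k.+1 & alpha k.+1 - c <= S k.+1],
    h <= alpha k.+1 < c /\ h <= S k.+1 |
    [/\ h <= alpha k.+1 < c, 1 <= theta k.+1 & 2 * h - c <= S k.+1]].
  have hc : c <= 2 * h by nra.
  elim: k => [|k IH].
    by apply: Or31; rewrite SS /S big_geq// mul0r; split; lra.
  have := SS k.+1; have := lamc k.+1; have := a_gt0 k.+1; have := th_ge0 k.+1.
  have := st k.+1; move: IH.
  move: (S k.+1) (S k.+2) => s s'.
  move: (alpha k.+1) (alpha k.+2) => a b.
  move: (theta k.+1) (theta k.+2) => t' t.
  move: (lam k.+2) => l.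
  move=> IH stp t'0 a0' cl s'E.
  have sE : 0 <= s by case: IH => [[]|[]|[]]; lra.
  have [cb|bc] := leP c b; first by apply: Or31; split; lra.
  case: stp => [al bE ab tE|al la lb bA _ tE|al b0 bl lb bA tE].
  - case: IH => [[ca _ _]|[/andP[ha ac] hs]|[/andP[ha ac] t1 hs]].
    + by lra.
    + apply: Or33; split; [lra| |lra].
      by rewrite tE ler_pdivlMr// mul1r.
    (* theta >= 1, so b^2 >= 2 a^2 >= 2 h^2 = c^2, against b < c. *)
    + exfalso; nra.
  - by lra.
  - case: IH => [[ca _ hs]|[/andP[ha ac] hs]|[/andP[ha ac] t1 hs]]; try lra.
    have hb : h <= b.
      have cl2 : c ^+ 2 <= l ^+ 2 by nra.
      by rewrite -ler_sqr ?nnegrE; lra.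
    by apply: Or32; split; lra.
move=> [|k]; first by rewrite big_geq// mul0r.
suff : 0 <= S k.+1 by rewrite subr_ge0.
have hc : c <= 2 * h by nra.
by case: (inv k) => [[]|[]|[]]; lra.
Qed.

(** * Energy and boundedness of the iterates *)

(** The argument uses the iterates only through real sequences: dist is the
squared distance to x-star, G the squared gradient norm, F the optimality gap,
p the product of consecutive gradients and D the squared norm of their
difference. *)
Section Energy.
Variables (R : realType) (lam alpha theta dist G F p D : nat -> R) (c : R).
Hypotheses (G_ge0 : forall k, 0 <= G k) (F_ge0 : forall k, 0 <= F k)
  (D_ge0 : forall k, 0 <= D k).
Hypothesis dist_step : forall k, 0 <= alpha k ->
  dist k.+1 <= dist k - 2 * alpha k * F k + alpha k ^+ 2 * G k.
Hypothesis descent : forall k, alpha k * p k <= F k - F k.+1.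
Hypothesis secant : forall k,
  [/\ alpha k * G k.+1 = alpha k * G k + (alpha k - 2 * lam k.+1) * D k,
      alpha k * p k = alpha k * G k - lam k.+1 * D k &
      lam k.+1 ^+ 2 * D k <= alpha k ^+ 2 * G k].
Hypotheses (alpha0_gt0 : 0 < alpha 0%N) (theta0_ge0 : 0 <= theta 0%N).
Hypothesis steps : forall k, adabb_step (lam k.+1) (alpha k) (theta k)
  (alpha k.+1) (theta k.+1).
Hypothesis lam1_itv : lam 1%N < alpha 0%N < 2 * lam 1%N.

Definition energy k :=
  dist k.+1 + alpha k ^+ 2 * G k + 2 * alpha k * (1 + theta k) * F k.

Let M1 := adabb_M1 (lam 1%N) (alpha 0%N) (alpha 1%N).
Let P1 := adabb_P1 (lam 1%N) (alpha 0%N) (alpha 1%N).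

(** The square of the radius of the ball on which L is given. *)
Definition energy_bound := dist 0%N + alpha 0%N ^+ 2 * (1 + 2 * M1) * G 0%N
  + Num.max (2 * P1 - 2 * alpha 0%N) 0 * F 0%N.

Let step k : 0 < lam k.+1 -> 0 < alpha k -> 0 <= theta k ->
  step_bounds (lam k.+1) (alpha k) (theta k) (alpha k.+1) (theta k.+1).
Proof. by move=> *; apply: adabb_stepP. Qed.

Lemma energy_le k : 0 < lam k.+1 -> 0 < alpha k -> 0 <= theta k ->
  energy k.+1 <= energy k.
Proof.
move=> l0 a0 t0; have st := step l0 a0 t0.
have [b0 t1] := step_gt0 l0 a0 st.
have := step_theta l0 a0 t0 st.
have [GE pE lD] := secant k.
have := step_grad l0 a0 st (G_ge0 k) (D_ge0 k) lD GE pE.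
have := descent k; have := dist_step (ltW b0); have := F_ge0 k.
rewrite /energy.
move: (F k) (F k.+1) (G k) (G k.+1) (dist k.+1) (dist k.+2) (p k) GE pE lD.
move=> F' F1 G' G1 d d' q _ _ _ F'0 dd pF gr th.
have : alpha k.+1 * theta k.+1 * (alpha k * q) <=
    alpha k.+1 * theta k.+1 * (F' - F1).
  by apply: ler_wpM2l => //; apply: mulr_ge0 => //; exact: ltW.
have : alpha k.+1 * theta k.+1 * F' <= alpha k * (1 + theta k) * F'.
  exact: ler_wpM2r.
lra.
Qed.

Let lam1_gt0 : 0 < lam 1%N. Proof. by case/andP: lam1_itv; lra. Qed.

Lemma adabb_P1E : P1 = alpha 1%N * theta 1%N.
Proof.
case/andP: lam1_itv => la al.
have la2 : alpha 0%N / 2 < lam 1%N by lra.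
rewrite /P1 /adabb_P1 leNgt la la2 /=.
case: (steps 0) => [[? _ _]|[_ _ ->]|[? _ _]]; [lra| |lra].
by field; rewrite !gt_eqF.
Qed.

Lemma adabb_M1E :
  alpha 0%N ^+ 2 * M1 = alpha 1%N ^+ 2 * (alpha 0%N / lam 1%N - 1).
Proof.
case/andP: lam1_itv => la al.
have la2 : alpha 0%N / 2 < lam 1%N by lra.
rewrite /M1 /adabb_M1 leNgt la la2 /=.
by field; rewrite !gt_eqF.
Qed.

Lemma dist_le_energy_bound : dist 0%N <= energy_bound /\ dist 1%N <= energy_bound.
Proof.
have M1_ge0 : 0 <= alpha 0%N ^+ 2 * M1.
  rewrite adabb_M1E; case/andP: lam1_itv => la al.
  apply: mulr_ge0; first exact: sqr_ge0.
  by rewrite subr_ge0 ler_pdivlMr; lra.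
have d1 := dist_step (ltW alpha0_gt0).
have MG := mulr_ge0 M1_ge0 (G_ge0 0%N).
have aG := mulr_ge0 (sqr_ge0 (alpha 0%N)) (G_ge0 0%N).
have aF := mulr_ge0 (ltW alpha0_gt0) (F_ge0 0%N).
rewrite /energy_bound; set m := Num.max _ _.
have mF : 0 <= m * F 0%N by apply: mulr_ge0 => //; rewrite le_max lexx orbT.
by split; lra.
Qed.

(** Monotonicity of the energy from index 0 is too weak here: it puts 1 in the
place of 2 M_1 and alpha_0 (1 + theta_0) in the place of P_1, which can only
enlarge the bound.
The equality of [middle_step_grad] keeps M_1 and P_1. *)
Lemma energy1_le : energy 1%N <= energy_bound.
Proof.
have st := step lam1_gt0 alpha0_gt0 theta0_ge0.
have [b0 t1] := step_gt0 lam1_gt0 alpha0_gt0 st.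
have tE : theta 1%N = 2 * alpha 1%N / alpha 0%N - alpha 1%N / lam 1%N.
  by case/andP: lam1_itv => la al; case: st => [?|//|?]; lra.
have [GE pE _] := secant 0.
have [ln an] : lam 1%N != 0 /\ alpha 0%N != 0 by rewrite !gt_eqF.
have := middle_step_grad ln an tE GE pE.
rewrite -adabb_M1E.
have := ler_wpM2l (mulr_ge0 (ltW b0) t1) (descent 0).
have := dist_step (ltW alpha0_gt0); have := dist_step (ltW b0).
rewrite /energy /energy_bound adabb_P1E; set m := Num.max _ _.
have : (2 * (alpha 1%N * theta 1%N) - 2 * alpha 0%N) * F 0%N <= m * F 0%N.
  by apply: ler_wpM2r => //; rewrite le_max lexx.
lra.
Qed.

(** x_k and x_(k+1) in the ball give lambda_(k+1) >= c > 0, hence positivity of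
alpha_(k+1); the energy at k+1, which dominates d_(k+2), is then within the
bound, so x_(k+2) is in the ball and the energy decreases once more. *)
Lemma adabb_bounded : 0 < c ->
  (forall k, dist k <= energy_bound -> dist k.+1 <= energy_bound ->
    c <= lam k.+1) ->
  forall k, [/\ c <= lam k.+1, 0 < alpha k & 0 <= theta k].
Proof.
move=> c0 lam_ge.
have [d0 d1] := dist_le_energy_bound.
have dist_energy k : 0 < alpha k -> 0 <= theta k -> dist k.+1 <= energy k.
  move=> ak tk; rewrite /energy -addrA lerDl addr_ge0//.
    by rewrite mulr_ge0 ?sqr_ge0.
  by rewrite !mulr_ge0 ?(ltW ak)// addr_ge0.
have inv k : [/\ 0 < alpha k, 0 <= theta k, dist k <= energy_bound,
    dist k.+1 <= energy_bound & energy k.+1 <= energy_bound].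
  elim: k => [|k [ak tk dk dk1 ek]]; first by split=> //; exact: energy1_le.
  have l0 := lt_le_trans c0 (lam_ge _ dk dk1).
  have [b0 t1] := step_gt0 l0 ak (step l0 ak tk).
  have dk2 := le_trans (dist_energy _ b0 t1) ek.
  have l1 := lt_le_trans c0 (lam_ge _ dk1 dk2).
  by split=> //; exact: le_trans (energy_le l1 b0 t1) ek.
by move=> k; have [ak tk dk dk1 _] := inv k; split=> //; exact: lam_ge.
Qed.

End Energy.

(** * The stepsize bound *)

Lemma adabb_bb_lambda_ge (R : realType) (n : nat) (f : 'rV[R]_n -> R)
    (xstar : 'rV[R]_n) (x : nat -> 'rV[R]_n) (alpha theta : nat -> R) (L : R) :
  convex_function setT f -> (forall z, differentiable f z) ->
  minimizers f xstar -> adabb f x alpha theta ->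
  (forall k, grad f (x k.+1) <> grad f (x k)) ->
  0 < L -> smooth_on f (eball xstar (adabb_radius f xstar x alpha)) L ->
  bb_lambda f x 1 < alpha 0%N < 2 * bb_lambda f x 1 ->
  forall k, [/\ 1 / L <= bb_lambda f x k.+1, 0 < alpha k & 0 <= theta k].
Proof.
move=> f_convex f_diff xstar_min [a0 th0 xE st] neq L0 smooth lam1_itv.
pose dist k := dot (x k - xstar) (x k - xstar).
pose G k := dot (grad f (x k)) (grad f (x k)).
pose F k := f (x k) - f xstar.
pose p k := dot (grad f (x k.+1)) (grad f (x k)).
pose D k := dot (grad f (x k.+1) - grad f (x k)) (grad f (x k.+1) - grad f (x k)).
apply: (@adabb_bounded _ (bb_lambda f x) alpha theta dist G F p D).
- by move=> k; exact: dot_ge0.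
- by move=> k; rewrite subr_ge0; exact: xstar_min.
- by move=> k; exact: dot_ge0.
- by move=> k; rewrite /dist xE; exact: gradient_step_dist.
- move=> k; rewrite /F /p.
  have := convex_grad_le f_convex (x k) (f_diff (x k.+1)).
  by rewrite {2}xE subKr dotZr opprB addrA subrK.
- move=> k; have dxE : x k.+1 - x k = - (alpha k *: grad f (x k)).
    by rewrite xE addrC addKr.
  exact: secant_relations dxE (bb_lambdaE (neq k)).
- by [].
- by [].
- by move=> k; exact: (st k.+1).
- by [].
- by rewrite divr_gt0.
have in_ball k : dist k <= energy_bound (bb_lambda f x) alpha dist G F ->
    eball xstar (adabb_radius f xstar x alpha) (x k).
  rewrite /eball /adabb_radius /= !enorm_sqr; exact: ler_wsqrtr.
move=> k dk dk1.
exact: smooth_bb_lambda L0 smooth (in_ball _ dk) (in_ball _ dk1) (neq k).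
Qed.

Lemma is_i0_middle (R : realType) (lam alpha : nat -> R) (i : nat) :
  index_set2 lam alpha 1 -> is_i0 lam alpha i <-> i = 0%N.
Proof.
move=> I2; split=> [|->]; last by apply: Or31; split=> //; apply: Or31.
case: (I2) => _ /andP[/= al la].
have I1F : ~ index_set1 lam alpha 1 by case=> _ /=; lra.
have I3F : ~ index_set3 lam alpha 1 by case=> _ /andP[_] /=; lra.
by case=> [[]//|[_ [[]|[]|[]|[]]]|[_ [[]|[]]]].
Qed.

Unset Implicit Arguments.
Set Strict Implicit.

Theorem mainTheorem5 (R : realType) (n : nat) (f : 'rV[R]_n -> R)
    (xstar : 'rV[R]_n) (x : nat -> 'rV[R]_n) (alpha theta : nat -> R) (L : R)
    (f_convex : convex_function setT f)
    (f_diff : forall z, differentiable f z)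
    (grad_lip : locally_lipschitz (grad f))
    (xstar_min : minimizers f xstar)
    (xs_adabb : adabb f x alpha theta)
    (grad_neq : forall k : nat, (1 <= k)%N -> grad f (x k) <> grad f (x k.-1))
    (theta0E : theta 0%N = theta0_choice (bb_lambda f x 1) (alpha 0%N))
    (L_gt0 : 0 < L)
    (f_smooth :
      smooth_on f (eball xstar (adabb_radius f xstar x alpha)) L)
    (alpha0_itv : bb_lambda f x 1 < alpha 0%N < 2 * bb_lambda f x 1) :
  [/\ index_set2 (bb_lambda f x) alpha 1%N,
      forall i : nat, is_i0 (bb_lambda f x) alpha i <-> i = 0%N &
      forall k : nat, (1 <= k)%N ->
        k%:R / L <= \sum_(1 <= i < k.+1) alpha i].
Proof.
have [a0 th0 _ st] := xs_adabb.
have /andP[la al] := alpha0_itv.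
have I2 : index_set2 (bb_lambda f x) alpha 1%N.
  by split=> //=; apply/andP; split; lra.
have neq k : grad f (x k.+1) <> grad f (x k) by exact: (grad_neq k.+1).
have bnd := adabb_bb_lambda_ge f_convex f_diff xstar_min xs_adabb neq
  L_gt0 f_smooth alpha0_itv.
split=> // [i|k _].
  exact: is_i0_middle.
have c0 : 0 < 1 / L by rewrite divr_gt0.
have step j : step_bounds (bb_lambda f x j.+1) (alpha j) (theta j)
    (alpha j.+1) (theta j.+1).
  have [lj aj tj] := bnd j.
  by apply: adabb_stepP => //; [exact: lt_le_trans lj|exact: (st j.+1)].
have -> : k%:R / L = k%:R * (1 / L) by rewrite div1r.
apply: (@sum_stepsizes _ (1 / L) (bb_lambda f x) alpha theta); first 3 last.
- have [l1 _ _] := bnd 0%N.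
  apply: le_trans l1 _.
  by case: (step 0%N); lra.
- by move=> j; case: (bnd j).
- exact: step.
- exact: c0.
- exact: a0.
- exact: th0.
Qed.
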